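(* The Gromov--Hausdorff distance between $S^2$ and $S^k$ satisfies $$\pi - 2\, d_{\mathrm{GH}}(S^2, S^k) = \Theta\left(\frac{1}{\sqrt{k}}\right);$$ that is, there are constants $0<c\le C$ such that $\frac{c}{\sqrt{k}}\le \pi - 2\, d_{\mathrm{GH}}(S^2, S^k)\le \frac{C}{\sqrt{k}}$ for all integers $k>2$.
   Context: For an integer $n\ge 1$, $S^n=\{x\in\mathbb{R}^{n+1} : \langle x,x\rangle=1\}$ is the unit sphere equipped with the geodesic metric $d_{S^n}(x,x')=\arccos(\langle x,x'\rangle)$. A correspondence between sets $X$ and $Y$ is a relation $R\subseteq X\times Y$ whose coordinate projections to $X$ and to $Y$ are both surjective. For metric spaces $(X,d_X)$, $(Y,d_Y)$, the distortion of $R$ is $\operatorname{dis}(R)=\sup_{(x,y),(x',y')\in R}|d_X(x,x')-d_Y(y,y')|$. The Gromov--Hausdorff distance between compact metric spaces $X,Y$ is given by $2\,d_{\mathrm{GH}}(X,Y)=\inf_R \operatorname{dis}(R)$, the infimum being over all correspondences $R\subseteq X\times Y$. $\Theta(1/\sqrt{k})$ denotes a positive function of $k$ that is bounded above and below by positive constant multiples of $1/\sqrt{k}$. *)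

(* Defs.v *)
From mathcomp Require Import all_boot all_order all_algebra.
From mathcomp Require Import all_classical all_reals all_analysis.

Set Implicit Arguments.
Unset Strict Implicit.
Unset Printing Implicit Defensive.

Import Order.TTheory GRing.Theory Num.Theory.

Local Open Scope classical_set_scope.
Local Open Scope ring_scope.

(* MathComp's [dotmx] needs a numClosedFieldType, and the norm that
   MathComp-Analysis puts on row vectors is the max norm; neither is the
   Euclidean structure of R^m. *)
Definition dotp (R : realType) (m : nat) (x y : 'rV[R]_m) : R :=
  \sum_(i < m) x ord0 i * y ord0 i.

Definition sphere (R : realType) (n : nat) : set 'rV[R]_n.+1 :=
  [set x | dotp x x = 1].

Definition geodesic (R : realType) (m : nat) (x y : 'rV[R]_m) : R :=
  acos (dotp x y).

Definition correspondence (T U : Type) (X : set T) (Y : set U)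
    (C : set (T * U)) : Prop :=
  [/\ C `<=` X `*` Y, fst @` C = X & snd @` C = Y].

(* A metric space is a carrier set [X : set T] with a distance [dX] on the
   ambient type.  The supremum and the infimum are taken in \bar R, where they
   always exist, rather than in R, where [sup] and [inf] are 0 by convention on
   unbounded sets. *)
Definition distortion (R : realType) (T U : Type)
    (dX : T -> T -> R) (dY : U -> U -> R) (C : set (T * U)) : \bar R :=
  ereal_sup [set `|dX p.1 q.1 - dY p.2 q.2|%:E | p in C & q in C].

Definition gh_dist (R : realType) (T U : Type) (X : set T) (dX : T -> T -> R)
    (Y : set U) (dY : U -> U -> R) : \bar R :=
  ((2^-1)%:E *
   ereal_inf [set distortion dX dY C | C in correspondence X Y])%E.

Definition gh_sphere (R : realType) (m n : nat) : \bar R :=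
  gh_dist (@sphere R m) (@geodesic R m.+1) (@sphere R n) (@geodesic R n.+1).

(* Main.v *)
(** Upper bound on pi - 2 d_GH.  Cover S^2 by at most k + 1 cells of diameter
    O(1 / sqrt k).  A correspondence pulls the cells back to k + 1 sets covering
    S^k, and by Lusternik-Schnirelmann one of them contains two almost antipodal
    points; their partners in S^2 are O(1 / sqrt k) apart.

    Lusternik-Schnirelmann is derived from the octahedral Tucker lemma on the
    sign vectors of length M = (k + 1) L.  A sign vector with at most M - (k + 1)
    alternations is labelled by its number of alternations.  After multiplication
    by (-1)^p the remaining ones have so few zeros and sign changes that one of
    the k + 1 blocks of length L is constant; hence their vectors of block sums
    are large and can be normalised to points of S^k, and comparable sign vectors
    give points that are close when L is large.

    Lower bound.  Take k + 1 lines in R^3, spanned by unit vectors p_i, that are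
    pairwise at angle at least c / sqrt k, the first three being the coordinate
    axes.  Relate x in S^k with largest coordinate x_i to sign(x_i) p_i, and
    y in S^2 with largest coordinate y_j to sign(y_j) e_j in S^k.  Points of S^k
    closer than c / sqrt k never select antipodal vectors p_i and - p_i, and the
    relation is invariant under the antipodal map. *)
Require Import Defs.
From mathcomp Require Import all_boot all_order all_algebra.
From mathcomp Require Import fingroup perm.
From mathcomp Require Import all_classical all_reals all_analysis.
From mathcomp Require Import ring lra zify.
Import Order.TTheory GRing.Theory Num.Theory.
Import numFieldNormedType.Exports.

(** * The octahedral Tucker lemma *)

(** Each orbit [{x, h x}] has two elements with equal values, so it cancels mod 2; comparing
    [enum_rank] picks one representative per orbit. *)
Lemma addb_involution_false (T : finType) (P : pred T) (F : T -> bool)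
    (h : T -> T) :
  involutive h -> (forall x, P x -> P (h x)) -> (forall x, P x -> h x != x) ->
  (forall x, P x -> F (h x) = F x) -> \big[addb/false]_(x | P x) F x = false.
Proof.
move=> hK hP0 h_neq hF.
have hP x : P (h x) = P x by apply/idP/idP => /hP0 //; rewrite hK.
rewrite (bigID (fun x => enum_rank x < enum_rank (h x))) /=.
rewrite [X in _ (+) X](reindex_inj (inv_inj hK)) /=.
rewrite -[RHS](addbb (\big[addb/false]_(x | P x && (enum_rank x < enum_rank (h x))) F x)).
congr (_ (+) _); apply: eq_big => [x|x /andP[/[!hP] Px _]]; last exact: hF.
rewrite hP hK; have [Px|//] := boolP (P x); rewrite /= -leqNgt leq_eqVlt.
have /negPf -> // : val (enum_rank x) != enum_rank (h x).
by rewrite (inj_eq val_inj) (inj_eq enum_rank_inj) eq_sym h_neq.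
Qed.

Fixpoint alternates (b : bool) (s : seq bool) : bool :=
  if s is c :: s' then (c == b) && alternates (~~ b) s' else true.

Lemma alternates_negb b s : alternates b (map negb s) = alternates (~~ b) s.
Proof. by elim: s b => //= c s IHs b; rewrite IHs; case: b c => [] []. Qed.

(** Suppose deleting [i] leaves a sequence alternating from [b]. If the deleted sign equals a
    neighbouring one, deleting that neighbour works as well and the two cancel. Otherwise [i] is the
    last entry of a sequence alternating from [b], or the first of one alternating from [~~ b]. *)
Lemma alternates_delete (T : eqType) (sg : T -> bool) (s : seq T) b :
  uniq s -> s != [::] ->
  \big[addb/false]_(i <- s) alternates b (map sg (seq.filter (predC1 i) s))
    = alternates b (map sg s) (+) alternates (~~ b) (map sg s).
Proof.
elim: s b => // a s IHs b /= /andP[as_ us] _.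
rewrite big_cons /= eqxx /=.
have -> : seq.filter (predC1 a) s = s.
  by apply/all_filterP/allP => x xs /=; apply: contraNneq as_ => <-.
have -> : \big[addb/false]_(i <- s)
    alternates b (map sg (if a != i then a :: seq.filter (predC1 i) s else seq.filter (predC1 i) s))
  = (sg a == b) && \big[addb/false]_(i <- s) alternates (~~ b) (map sg (seq.filter (predC1 i) s)).
  rewrite (big_morph (andb (sg a == b)) (andb_addr _) (andbF _)) !big_seq.
  apply: eq_bigr => i i_s; suff -> : a != i by [].
  by apply: contraNneq as_ => ->.
have [->|s0] := eqVneq s [::].
  by rewrite big_nil /=; case: (sg a) b => [] [].
by rewrite IHs // negbK; case: (sg a) b (alternates _ _) (alternates _ _) => [] [] [] [].
Qed.

Lemma alternates_sorted_ltn b (s : seq (nat * bool)) :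
  alternates b (unzip2 s) -> sorted (fun u v => u.1 <= v.1) s ->
  {in s &, forall u v, u.1 = v.1 -> u.2 = v.2} -> sorted ltn (unzip1 s).
Proof.
elim: s b => // u [|v s] IHs b //= /and3P[/eqP ub /eqP vb altb] /andP[uv sv] eqs.
apply/andP; split; last first.
  apply: (IHs (~~ b)) => //=; first by rewrite vb eqxx.
  by move=> x y xs ys; apply: eqs; rewrite inE ?xs ?ys orbT.
rewrite ltn_neqAle uv andbT; apply/eqP => /eqs.
rewrite !inE !eqxx orbT => /(_ isT isT); rewrite ub vb.
by case: (b).
Qed.

Section OctahedralTucker.
Variable n : nat.

Definition signvec := {ffun 'I_n -> option bool}.
Definition negv (x : signvec) : signvec := [ffun i => omap negb (x i)].
Definition subv (x y : signvec) := forall i, x i != None -> y i = x i.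
Definition zerov : signvec := [ffun=> None].

Implicit Types q r : {perm 'I_n} * {ffun 'I_n -> bool}.

(* The pairs [q] (an ordering of the coordinates and a choice of signs) encode
   the maximal chains [flag q 1], ..., [flag q n] of nonzero sign vectors. *)
Definition flag q (k : nat) : signvec :=
  [ffun j => if (q.1^-1%g j < k)%N then Some (q.2 j) else None].

Lemma flag_subv q k l : k <= l -> subv (flag q k) (flag q l).
Proof. by move=> kl j; rewrite !ffunE; case: ltnP => // /leq_trans ->. Qed.

Lemma flag_neq0 q k : 0 < n -> 0 < k -> flag q k != zerov.
Proof.
move=> n0 k0; apply/eqP => /ffunP /(_ (q.1 (Ordinal n0))).
by rewrite !ffunE permK /= k0.
Qed.

Lemma eq_flag q r k :
  (forall j, (q.1^-1%g j < k) = (r.1^-1%g j < k)) ->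
  (forall j, r.1^-1%g j < k -> q.2 j = r.2 j) -> flag q k = flag r k.
Proof. by move=> h1 h2; apply/ffunP => j; rewrite !ffunE h1; case: ifP => // /h2 ->. Qed.

Variables (lab : signvec -> nat) (sgn : signvec -> bool).
Hypothesis lab_neg : forall x, x != zerov -> lab (negv x) = lab x.
Hypothesis sgn_neg : forall x, x != zerov -> sgn (negv x) = ~~ sgn x.

Let labels q (I : seq nat) := [seq (lab (flag q i), sgn (flag q i)) | i <- I].
Let lable (u v : nat * bool) := u.1 <= v.1.
(* Sorting by label and asking the signs to alternate is Ky Fan's condition: it
   forces distinct labels as soon as there is no complementary pair. *)
Let alt b q I := alternates b (unzip2 (sort lable (labels q I))).

Lemma eq_alt b q r I : {in I, forall k, flag q k = flag r k} -> alt b q I = alt b r I.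
Proof.
move=> qr; congr (alternates b (unzip2 (sort lable _))).
by apply/eq_in_map => i /qr ->.
Qed.

Lemma alt_neg b q r I : 0 < n -> all (fun k => 0 < k) I ->
  {in I, forall k, flag q k = negv (flag r k)} -> alt b q I = alt (~~ b) r I.
Proof.
move=> n0 /allP I0 qr; rewrite /alt -alternates_negb.
have -> : labels q I = [seq (u.1, ~~ u.2) | u <- labels r I].
  rewrite -map_comp; apply/eq_in_map => i iI /=.
  by rewrite qr // lab_neg ?sgn_neg // flag_neq0 // I0.
by rewrite sort_map /unzip2 -!map_comp.
Qed.

(** This is [alternates_delete] on the indices sorted by label; the sort is stable, so deleting an
    index commutes with it. *)
Lemma alt_delete q I : uniq I -> I != [::] ->
  \big[addb/false]_(i <- I) alt true q (seq.filter (predC1 i) I) = alt true q I (+) alt false q I.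
Proof.
move=> uI I0.
have altE c J : alt c q J =
    alternates c [seq sgn (flag q i) |
      i <- sort (relpre (fun i => (lab (flag q i), sgn (flag q i))) lable) J].
  by rewrite /alt /labels sort_map /unzip2 -map_comp.
rewrite !altE -alternates_delete ?sort_uniq //; last first.
  by rewrite -size_eq0 size_sort size_eq0.
rewrite [RHS](perm_big I) ?perm_sort //=; apply: eq_bigr => i _.
by rewrite altE filter_sort // => [x y|y x z]; [exact: leq_total | exact: leq_trans].
Qed.

(* The chains [flag q 1], ..., [flag q d.+1] with [hemi d q] are the d-simplices
   of the d-dimensional hemisphere of the octahedral sphere. *)
Definition hemi d q :=
  [forall j : 'I_n, ((d < j) ==> (q.1 j == j)) && ((d <= j) ==> q.2 j)].

Lemma hemiP d q :
  reflect ((forall j : 'I_n, d < j -> q.1 j = j) /\ (forall j : 'I_n, d <= j -> q.2 j))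
    (hemi d q).
Proof.
apply: (iffP forallP) => [h|[h1 h2] j]; last first.
  by apply/andP; split; apply/implyP => dj; [rewrite h1 | exact: h2].
by split=> j dj; have /andP[/implyP h1 /implyP h2] := h j; [apply/eqP/h1 | apply: h2].
Qed.

(* A facet missing an inner vertex lies in exactly two simplices, exchanged by
   a transposition of the two neighbouring coordinates. *)
Lemma hemi_facet_inner d i : 0 < i < d.+2 -> d.+1 < n ->
  \big[addb/false]_(q | hemi d.+1 q) alt true q (seq.filter (predC1 i) (iota 1 d.+2)) = false.
Proof.
move=> /andP[i0 id] dn.
have in_ : i < n by lia.
have i1n : i.-1 < n by lia.
(* Swapping positions [i.-1] and [i] of the ordering changes only [flag q i], the deleted vertex. *)
pose t := tperm (Ordinal i1n) (Ordinal in_).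
have tV (x : 'I_n) k : k != i -> (t x < k) = (x < k).
  by move=> ki; rewrite /t; case: tpermP => [->|->|//] /=; lia.
have tfix (j : 'I_n) : d.+1 < j -> t j = j.
  by move=> dj; rewrite /t tpermD //; apply/eqP => /(congr1 val) /=; lia.
apply: (@addb_involution_false _ _ _ (fun q => ((t * q.1)%g, q.2))).
- by move=> [p s] /=; rewrite mulgA /t tperm2 mul1g.
- move=> [p s] /hemiP[/= pf sf]; apply/hemiP; split=> //= j dj.
  by rewrite permM tfix // pf.
- move=> [p s] _; apply/eqP => -[] /permP /(_ (Ordinal in_)).
  by rewrite permM tpermR => /perm_inj /(congr1 val) /=; lia.
move=> [p s] _; apply: eq_alt => k; rewrite mem_filter /= => /andP[ki _].
apply: eq_flag => //= j; rewrite invMg permM /t tpermV -/t.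
exact: tV.
Qed.

(* The facets missing the top vertex cancel in pairs except on the boundary,
   which consists of the lower hemisphere and its antipode. *)
Lemma hemi_facet_top d : d.+1 < n ->
  \big[addb/false]_(q | hemi d.+1 q) alt true q (iota 1 d.+1) =
  \big[addb/false]_(q | hemi d q) (alt true q (iota 1 d.+1) (+) alt false q (iota 1 d.+1)).
Proof.
move=> dn; have n0 : 0 < n by lia.
have := mem_iota 1 d.+1; move: (iota 1 d.+1) => I memI.
pose e := Ordinal dn; pose e' := Ordinal (ltnW dn).
(* [flip] reverses the sign of the coordinate at position [d.+1], which enters no [flag q k] with
   [k <= d.+1]. It preserves [hemi d.+1] unless that coordinate is [e] itself. *)
pose flip q : {perm 'I_n} * {ffun 'I_n -> bool} :=
  (q.1, [ffun j => (j == q.1 e) (+) q.2 j]).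
(* If [q.1 e = e], the facet is on the boundary: [q] lies in [hemi d] when [q.2 e'] holds, and
   [flips q] does otherwise. *)
pose flips q : {perm 'I_n} * {ffun 'I_n -> bool} :=
  (q.1, [ffun j : 'I_n => (j < d.+1) (+) q.2 j]).
have flipsK : involutive flips.
  by move=> [p s]; congr pair; apply/ffunP => j; rewrite !ffunE addKb.
rewrite (bigID (fun q => q.1 e != e)) /= (@addb_involution_false _ _ _ flip).
- rewrite addFb (bigID (fun q => q.2 e')) /=.
  rewrite [X in _ (+) X](reindex_inj (inv_inj flipsK)) /=.
  have E1 q : hemi d.+1 q && ~~ (q.1 e != e) && q.2 e' = hemi d q.
    rewrite negbK; apply/idP/hemiP => [/andP[/andP[/hemiP[h1 h2] /eqP h3] h4]|[h1 h2]].
      split=> j; rewrite leq_eqVlt => /predU1P[dj|dj].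
      - by rewrite (_ : j = e) //; exact: val_inj.
      - by rewrite h1.
      - by rewrite (_ : j = e') //; exact: val_inj.
      by rewrite h2.
    rewrite h1 ?eqxx ?h2 //= !andbT; apply/hemiP.
    by split=> j dj; [rewrite h1 // ltnW | rewrite h2 // ltnW].
  have E2 q : hemi d.+1 (flips q) && ~~ ((flips q).1 e != e) && ~~ (flips q).2 e' = hemi d q.
    rewrite -E1 /= ffunE /= ltnSn /=; congr (_ && _ && _); last by rewrite negbK.
    by apply: eq_forallb => j /=; rewrite ffunE; case: (ltnP j d.+1).
  rewrite big_split /=; rewrite (eq_bigl _ _ E1) (eq_bigl _ _ E2).
  congr (_ (+) _); apply: eq_bigr => q.
  move=> /hemiP[h1 h2]; apply: alt_neg => //.
    by apply/allP => k; rewrite memI => /andP[].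
  move=> k; rewrite memI => /andP[_ kd]; apply/ffunP => j; rewrite !ffunE /=.
  case: ltnP => //= jk; case: ltnP => //= dj.
  have qj : (q.1^-1)%g j = j by apply: (@perm_inj _ q.1); rewrite permKV h1.
  by move: jk; rewrite qj; lia.
- by move=> [p s]; congr pair; apply/ffunP => j; rewrite !ffunE addKb.
- move=> q /andP[/hemiP[h1 h2] qe]; rewrite qe andbT; apply/hemiP; split=> //= j dj.
  rewrite ffunE h2 //; case: eqVneq => // jE; case/negP: qe.
  move: dj; rewrite leq_eqVlt => /predU1P[dj|dj].
    by rewrite -jE; apply/eqP; exact: val_inj.
  by rewrite -jE; apply/eqP; apply: (@perm_inj _ q.1); rewrite h1 // jE.
- move=> [p s] _; apply/eqP => -[] /ffunP /(_ (p e)); rewrite ffunE eqxx /=.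
  by case: (s _).
move=> q _; apply: eq_alt => k; rewrite memI => /andP[_ kd].
apply: eq_flag => //= j jk; rewrite ffunE; case: eqVneq => // jE.
by move: jk; rewrite jE permK /=; lia.
Qed.

(** Ky Fan's double count mod 2 of pairs of a simplex and a facet alternating from [true]. Counted
    by simplices, [alt_delete] gives the sum for [d.+1]; counted by facets, the inner ones cancel
    and the top ones leave the sum for [d]. For [d = 0] there is one vertex, which alternates from
    exactly one sign. *)
Lemma odd_alternating_flags d : d < n ->
  \big[addb/false]_(q | hemi d q) (alt true q (iota 1 d.+1) (+) alt false q (iota 1 d.+1)).
Proof.
elim: d => [|d IHd] dn.
  rewrite (big_pred1 ((1%g : {perm 'I_n}), [ffun=> true])) /=; last first.
    move=> [p s]; apply/hemiP/eqP => /= [[h1 h2]|[-> ->]]; last first.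
      by split=> j _; rewrite ?perm1 ?ffunE.
    congr pair; last by apply/ffunP => j; rewrite ffunE h2.
    apply/permP => j; rewrite perm1; have [/h1 //|] := ltnP 0 j.
    rewrite leqn0 => /eqP j0; have [/h1 pj|] := ltnP 0 (p j).
      by have := perm_inj pj.
    by rewrite leqn0 => /eqP pj0; apply: val_inj; rewrite /= j0.
  by rewrite /alt /=; case: (sgn _).
apply: etrans (IHd (ltnW dn)); rewrite -(@hemi_facet_top d) //.
under eq_bigr => q _ do rewrite -alt_delete ?iota_uniq //.
have iE : iota 1 d.+2 = iota 1 d.+1 ++ [:: d.+2].
  by rewrite -[d.+2]addn1 (iotaD 1 d.+1 1) add1n addn1.
rewrite exchange_big iE big_cat big_seq1 -iE.
rewrite big_seq big1 ?addFb => [|i]; last first.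
  by rewrite mem_iota => /andP[i0 id]; rewrite hemi_facet_inner // i0; lia.
apply: eq_bigr => q _; congr (alt _ _ _).
rewrite iE filter_cat [seq.filter _ [:: _]]/= eqxx cats0.
by apply/all_filterP/allP => i; rewrite mem_iota /=; lia.
Qed.

(** Without a complementary pair, an alternating maximal flag has [n] distinct labels, but only
    [n.-1] labels are available. The parity lemma at [d = n.-1] nevertheless provides such a
    flag. *)
Lemma octahedral_tucker : 0 < n -> (forall x, x != zerov -> (lab x).+1 < n) ->
  exists x y, [/\ x != zerov, subv x y, lab x = lab y & sgn x != sgn y].
Proof.
move=> n0 lab_lt; apply: contrapT => nocompl.
have same q i j : 0 < i -> 0 < j -> lab (flag q i) = lab (flag q j) ->
    sgn (flag q i) = sgn (flag q j).
  wlog ij : i j / i <= j.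
    by move=> H i0 j0 /[dup] ? /esym ?; case: (leqP i j) => [|/ltnW] ?; [|symmetry]; exact: H.
  move=> i0 j0 lij; apply/eqP/negP => sij; apply: nocompl.
  exists (flag q i), (flag q j); split=> //; first exact: flag_neq0.
    exact: flag_subv.
  exact/negP.
have := @odd_alternating_flags n.-1; rewrite prednK // leqnn => /(_ isT).
rewrite big1 // => q _.
have noalt b : alt b q (iota 1 n) = false; last by rewrite !noalt.
apply: contraTF isT; rewrite /alt => altb; set s := sort _ _ in altb.
have sE : s =i labels q (iota 1 n) by move=> u; rewrite mem_sort.
have inc : sorted ltn (unzip1 s).
  apply: alternates_sorted_ltn altb _ _.
    by apply: sort_sorted => u v; exact: leq_total.
  move=> u v; rewrite !sE => /mapP[i /[1!mem_iota] /andP[i0 _] ->].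
  by move=> /mapP[j /[1!mem_iota] /andP[j0 _] ->] /=; exact: same.
have : size (unzip1 s) <= size (iota 0 n.-1).
  apply: uniq_leq_size; first exact: (sorted_uniq ltn_trans ltnn).
  move=> l /mapP[u]; rewrite sE => /mapP[i /[1!mem_iota] /andP[i0 _] ->] -> /=.
  by have := lab_lt _ (flag_neq0 q _ n0 i0); rewrite mem_iota; lia.
by rewrite !size_map size_sort size_map !size_iota; lia.
Qed.
End OctahedralTucker.

(** * Alternations and Lusternik-Schnirelmann *)

(* The number of sign changes of [o :: s], zeros ([None]) being skipped; with
   [o = None] the first nonzero entry is counted as well. *)
Fixpoint altcount (o : option bool) (s : seq (option bool)) : nat :=
  match s with
  | [::] => 0
  | None :: s' => altcount o s'
  | Some b :: s' => (o != Some b) + altcount (Some b) s'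
  end.

Definition first_sign (s : seq (option bool)) := ohead (pmap id s).

Notation extends := (all2 (fun x y : option bool => (x == None) || (y == x))).

Lemma altcount_switch o b s : altcount o s <= (o != Some b) + altcount (Some b) s.
Proof. by elim: s o b => [|[c|] s IHs] o b //=; case: o b c => [[]|] [] [] /=; lia. Qed.

Lemma altcount_extends o s t : extends s t -> altcount o s <= altcount o t.
Proof.
elim: s t o => [|x s IHs] [|y t] o //= /andP[/predU1P[->|/eqP ->] st]; last first.
  by case: x => [b|]; rewrite ?leq_add2l IHs.
case: y => [b|] /=; last exact: IHs.
exact: leq_trans (IHs _ _ st) (altcount_switch _ _ _).
Qed.

Lemma altcount_first_sign b s :
  altcount None s = (first_sign s == Some b) + altcount (Some b) s.
Proof. by elim: s => [|[c|] s IHs] //=; rewrite /first_sign /=; case: b c {IHs} => [] []. Qed.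

Lemma altcount_eq0 s o : first_sign s = None -> altcount o s = 0.
Proof. by elim: s => [|[]]. Qed.

(** Let [c] be the first sign of [t]. Putting [c] in front saves [t] one alternation; since filling
    zeros never loses alternations, it must save [s] one too, so [s] also starts with [c]. *)
Lemma first_sign_extends s t : extends s t ->
  altcount None s = altcount None t -> first_sign s = first_sign t.
Proof.
move=> st eq_st; case ft: (first_sign t) => [c|]; last first.
  move: eq_st; rewrite (altcount_eq0 _ _ ft); case fs: (first_sign s) => [b|] //.
  by rewrite (altcount_first_sign b) fs eqxx.
have := altcount_extends (Some c) _ _ st; have := altcount_first_sign c s.
by have := altcount_first_sign c t; rewrite ft eqxx -eq_st /=; case: eqP => //= _; lia.
Qed.

Lemma altcount_count o s : altcount o s <= count isSome s.
Proof. by elim: s o => [|[c|] s IHs] o //=; apply: leq_add; rewrite ?leq_b1. Qed.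

Lemma altcount_size o s : altcount o s <= size s.
Proof. exact: leq_trans (altcount_count _ _) (count_size _ _). Qed.

Lemma altcount_negb o s :
  altcount (omap negb o) (map (omap negb) s) = altcount o s.
Proof.
elim: s o => [|[c|] s IHs] o //=; rewrite -(IHs (Some c)); congr (_ + _).
by case: o c => [[]|] [].
Qed.

Lemma first_sign_negb s : first_sign (map (omap negb) s) = omap negb (first_sign s).
Proof. by elim: s => [|[]]. Qed.

Lemma altcount_cat o s t : exists r, altcount o (s ++ t) = altcount o s + altcount r t.
Proof.
elim: s o => [|[c|] s IHs] o /=; [by exists o | | exact: IHs].
by have [r ->] := IHs (Some c); exists r; rewrite addnA.
Qed.

(** Pigeonhole: every block that does not alternate throughout loses at least one alternation, and
    fewer than [n] are lost in total. *)
Lemma altcount_block n L o s : size s = n * L -> n * L < altcount o s + n ->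
  exists j r, j < n /\ altcount r (take L (drop (j * L) s)) = L.
Proof.
elim: n o s => [|n IHn] o s ss; first by have := altcount_size o s; rewrite ss; lia.
have [r] := altcount_cat o (take L s) (drop L s); rewrite cat_take_drop => -> h.
have [/eqP sL|sL] := boolP (altcount o (take L s) == L).
  by exists 0, o; rewrite mul0n drop0.
have := altcount_size o (take L s).
rewrite size_takel ?ss ?leq_pmull // leq_eqVlt (negPf sL) /= => ts.
case: (IHn r (drop L s)) => [||j [r2 [jn h2]]].
- by rewrite size_drop ss; lia.
- by rewrite mulSn in h; lia.
by exists j.+1, r2; rewrite mulSn addnC -drop_drop.
Qed.

Lemma altcount_full_from b t : altcount (Some b) t = size t ->
  forall i, i < size t -> nth None t i = Some (~~ b (+) odd i).
Proof.
elim: t b => [|[c|] t IHt] b //= ht; last by have := altcount_size (Some b) t; lia.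
have tc := altcount_size (Some c) t.
have bc : c = ~~ b by case: b c ht tc => [] [] //= ht; rewrite add0n in ht; lia.
subst c => -[_|i it] /=; first by rewrite addbF.
rewrite (IHt (~~ b)) //; first by case: (b); case: odd.
by move: ht; case: (b) => /= -[].
Qed.

Lemma altcount_full o s : altcount o s = size s ->
  exists c, forall i, i < size s -> nth None s i = Some (c (+) odd i).
Proof.
case: s => [|[c|] s] /= hs; first by exists true.
  exists c => -[_|i it] /=; first by case: c {hs}.
  rewrite (altcount_full_from c) //; first by case: c {hs} => /=; case: odd.
  by have := altcount_size (Some c) s; case: eqP hs; lia.
by have := altcount_size o s; lia.
Qed.


Local Open Scope ring_scope.

(** * Euclidean inner product and normalisation *)

Section Dotp.
Variables (R : realType) (m : nat).
Implicit Types (x y z : 'rV[R]_m) (a : R).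

Lemma dotpC x y : dotp x y = dotp y x.
Proof. by apply: eq_bigr => i _; rewrite mulrC. Qed.

Lemma dotpDl x y z : dotp (x + y) z = dotp x z + dotp y z.
Proof. by rewrite -big_split; apply: eq_bigr => i _; rewrite mxE mulrDl. Qed.

Lemma dotpZl a x y : dotp (a *: x) y = a * dotp x y.
Proof. by rewrite mulr_sumr; apply: eq_bigr => i _; rewrite mxE mulrA. Qed.

Lemma dotpNl x y : dotp (- x) y = - dotp x y.
Proof. by rewrite -scaleN1r dotpZl mulN1r. Qed.

Lemma dotpDr x y z : dotp x (y + z) = dotp x y + dotp x z.
Proof. by rewrite dotpC dotpDl !(dotpC x). Qed.

Lemma dotpZr a x y : dotp x (a *: y) = a * dotp x y.
Proof. by rewrite dotpC dotpZl dotpC. Qed.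

Lemma dotpNr x y : dotp x (- y) = - dotp x y.
Proof. by rewrite dotpC dotpNl dotpC. Qed.

Lemma dotp_ge0 x : 0 <= dotp x x.
Proof. by apply: sumr_ge0 => i _; exact: sqr_ge0. Qed.

Lemma dotp_sphere_bound x y : dotp x x = 1 -> dotp y y = 1 -> -1 <= dotp x y <= 1.
Proof.
move=> x1 y1; have := dotp_ge0 (x + y); have := dotp_ge0 (x - y).
rewrite !dotpDl !dotpDr !dotpNl !dotpNr x1 y1 (dotpC y x); lra.
Qed.

Definition normalize x := (Num.sqrt (dotp x x))^-1 *: x.

Lemma normalizeN x : normalize (- x) = - normalize x.
Proof. by rewrite /normalize dotpNl dotpNr opprK scalerN. Qed.

Lemma dotp_normalize x : 0 < dotp x x -> dotp (normalize x) (normalize x) = 1.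
Proof.
move=> x0; rewrite dotpZl dotpZr -{3}(sqr_sqrtr (ltW x0)) expr2.
have : Num.sqrt (dotp x x) != 0 by rewrite gt_eqF // sqrtr_gt0.
by move: (Num.sqrt _) => r r0; field.
Qed.

(** With [a], [b] the norms, [|x - y|^2 = (a - b)^2 + 2 (a b - <x, y>)], so
    [a b - <x, y> <= e r <= e a b]; divide by [a b]. *)
Lemma normalize_close x y (r e : R) : 0 < r -> 0 <= e -> r <= dotp x x -> r <= dotp y y ->
  dotp (x - y) (x - y) <= 2 * e * r -> 1 - e <= dotp (normalize x) (normalize y).
Proof.
move=> r0 e0 rx ry xy; have x0 := lt_le_trans r0 rx; have y0 := lt_le_trans r0 ry.
rewrite dotpZl dotpZr.
have [xE yE] := (sqr_sqrtr (ltW x0), sqr_sqrtr (ltW y0)).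
have sx : 0 < Num.sqrt (dotp x x) by rewrite sqrtr_gt0.
have sy : 0 < Num.sqrt (dotp y y) by rewrite sqrtr_gt0.
have sr : 0 < Num.sqrt r by rewrite sqrtr_gt0.
have srE := sqr_sqrtr (ltW r0).
have rsx : Num.sqrt r <= Num.sqrt (dotp x x) by rewrite ler_wsqrtr.
have rsy : Num.sqrt r <= Num.sqrt (dotp y y) by rewrite ler_wsqrtr.
rewrite !dotpDl !dotpDr !dotpNl !dotpNr (dotpC y x) -xE -yE in xy.
move: xy srE sx sy sr rsx rsy.
move: (Num.sqrt r) (Num.sqrt (dotp x x)) (Num.sqrt (dotp y y)) (dotp x y).
move=> c a b d h cE a0 b0 c0 ca cb; rewrite -cE in h.
rewrite mulrA -invfM mulrC ler_pdivlMr ?mulr_gt0 //.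
have : e * c ^+ 2 <= e * (a * b).
  by apply: ler_wpM2l => //; rewrite expr2; apply: ler_pM => //; exact: ltW.
by have := sqr_ge0 (a - b); lra.
Qed.
End Dotp.

(** * From sign vectors to points: twisted block sums *)

Section BlockSums.
Variables (R : realType) (n L : nat).
Local Open Scope nat_scope.

(** The factor [(-1)^p] makes an alternating stretch constant, so that its sum does not cancel. *)
Definition twist (s : seq (option bool)) (p : nat) : R :=
  if nth None s p is Some b then ((-1) ^+ (b (+) odd p))%R else 0%R.

Definition blocksums (s : seq (option bool)) : 'rV[R]_n :=
  (\row_j \sum_(i < L) twist s (j * L + i))%R.

Lemma blocksums_negb s : blocksums (map (omap negb) s) = (- blocksums s)%R.
Proof.
apply/rowP => j; rewrite !mxE -sumrN; apply: eq_bigr => i _; rewrite /twist.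
have [ps|ps] := ltnP (j * L + i) (size s); last first.
  by rewrite !nth_default ?size_map // oppr0.
rewrite (nth_map None) //; case: (nth _ _ _) => [b|] /=; last by rewrite oppr0.
by rewrite addNb signrN.
Qed.

Lemma blocksums_large s : size s = n * L -> n * L < altcount None s + n ->
  (L%:R ^+ 2 <= dotp (blocksums s) (blocksums s))%R.
Proof.
move=> ss /(altcount_block _ _ _ _ ss)[j [r [jn hr]]].
have ts : size (take L (drop (j * L) s)) = L.
  by rewrite size_takel // size_drop ss -mulnBl leq_pmull // subn_gt0.
have [c hc] : exists c, forall i, i < L -> nth None s (j * L + i) = Some (c (+) odd i).
  have [c hc] := altcount_full _ _ (etrans hr (esym ts)).
  by exists c => i iL; rewrite -hc ?ts // nth_take // nth_drop.
rewrite /dotp (bigD1 (Ordinal jn)) //= -[leLHS]addr0 lerD ?sumr_ge0 //; last first.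
  by move=> i _; exact: sqr_ge0.
have -> : blocksums s ord0 (Ordinal jn) = ((-1) ^+ (c (+) odd (j * L)) * L%:R)%R.
  rewrite mxE (eq_bigr (fun=> ((-1) ^+ (c (+) odd (j * L)))%R)) => [|i _].
    by rewrite sumr_const card_ord mulr_natr.
  rewrite /twist hc //= oddD; congr (_ ^+ _)%R.
  by case: c {hc}; case: (odd i); case: (odd _).
by rewrite mulrACA -expr2 sqrr_sign mul1r expr2.
Qed.

(** The vectors differ only at zeros of [s]. Each alternation uses a nonzero entry, so there are at
    most [n] zeros, and each of the [n] block sums moves by at most [n]. *)
Lemma blocksums_close s t : size s = n * L -> extends s t ->
  n * L < altcount None s + n -> 
  (dotp (blocksums s - blocksums t) (blocksums s - blocksums t) <= n%:R ^+ 3)%R.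
Proof.
move=> ss st sn.
have st_nth p : nth None s p != None -> nth None t p = nth None s p.
  move: st {ss sn}; elim: s t p => [|x s IHs] [|y t] [|p] //= /andP[h st]; last exact: IHs.
  by case: x h => //= b /eqP.
have zeros : count (pred1 None) s <= n.
  have := altcount_count None s; have := count_predC (pred1 None) s.
  rewrite (@eq_count _ (predC _) isSome) => [|[]//]; rewrite ss => h1 h2.
  by rewrite -(leq_add2r (count isSome s)) h1; lia.
have bound (j : 'I_n) : (`|(blocksums s - blocksums t) ord0 j| <= n%:R)%R.
  rewrite !mxE -sumrB; apply: le_trans (ler_norm_sum _ _ _) _.
  apply: (@le_trans _ _ (\sum_(i < L) (nth None s (j * L + i) == None)%:R)%R).
    apply: ler_sum => i _; rewrite /twist; case: eqVneq => [->|/st_nth ->]; last first.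
      by rewrite subrr normr0.
    rewrite sub0r normrN; case: (nth _ t _) => [b|]; last by rewrite normr0.
    by rewrite normrX normrN1 expr1n.
  rewrite -natr_sum ler_nat; apply: leq_trans zeros.
  have ts : size (take L (drop (j * L) s)) = L.
    by rewrite size_takel // size_drop ss -mulnBl leq_pmull // subn_gt0.
  rewrite -[s in leqRHS](cat_take_drop (j * L)) -[drop _ s in leqRHS](cat_take_drop L).
  rewrite !count_cat; apply: leq_trans (leq_addl _ _); apply: leq_trans (leq_addr _ _).
  rewrite -[leqRHS]sum1_count (big_nth None) ts big_mkord [leqRHS]big_mkcond.
  by apply: leq_sum => i _; rewrite nth_take // nth_drop /=; case: eqP.
rewrite /dotp; apply: (@le_trans _ _ (\sum_(i < n) n%:R ^+ 2)%R).
  apply: ler_sum => j _; rewrite -expr2 -real_normK ?num_real //.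
  by rewrite ler_sqr ?nnegrE.
by rewrite sumr_const card_ord [leRHS]exprSr mulr_natr.
Qed.
End BlockSums.

Lemma sphere_labels_near_antipodes (R : realType) (n : nat)
    (l : 'rV[R]_n.+1 -> 'I_n.+1) (e : R) : 0 < e ->
  exists v w, [/\ dotp v v = 1, dotp w w = 1, l v = l w & dotp v w <= -1 + e].
Proof.
move=> e0; have [[v [v1 vl]]|nol] := pselect (exists v, dotp v v = 1 /\ l v = l (- v)).
  by exists v, (- v); rewrite !dotpNr dotpNl opprK v1; split=> //; lra.
have {}nol v : dotp v v = 1 -> l v != l (- v).
  by move=> v1; apply/eqP => vl; apply: nol; exists v.
(* Block sums differ by at most [n.+1 ^ 3] in squared norm, while their squared norms are at least
   [L ^ 2]; this choice makes the ratio at most [2 e]. *)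
have [L0 L0e] : exists L0 : nat, n.+1%:R ^+ 3 / e <= L0%:R.
  exists (Num.truncn (n.+1%:R ^+ 3 / e)).+1; apply: ltW; exact: truncnS_gt.
pose L := L0.+1; pose M := (n.+1 * L)%N.
pose sq (x : signvec M) := [seq x i | i <- enum 'I_M].
have size_sq x : size (sq x) = M by rewrite size_map size_enum_ord.
have nth_sq x (i : 'I_M) : nth None (sq x) i = x i.
  by rewrite (nth_map i) ?size_enum_ord // nth_ord_enum.
have sq_neg x : sq (negv _ x) = map (omap negb) (sq x).
  by rewrite -map_comp; apply: eq_map => i; rewrite /= ffunE.
have first_sq x : x != zerov M -> first_sign (sq x) != None.
  apply: contraNneq => fx; apply/eqP/ffunP => i; rewrite -nth_sq ffunE.
  have : all (pred1 None) (sq x) by elim: (sq x) fx => [|[]].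
  by move=> /(all_nthP None) /(_ i); rewrite size_sq => /(_ (ltn_ord i)) /eqP.
pose A x := altcount None (sq x).
pose big x := (M < A x + n.+1)%N.
pose pt x := normalize _ _ (blocksums R n.+1 L (sq x)).
have sq_large x : big x ->
    L%:R ^+ 2 <= dotp (blocksums R n.+1 L (sq x)) (blocksums R n.+1 L (sq x)).
  by move=> bx; apply: blocksums_large.
have L2 : 0 < L%:R ^+ 2 :> R by rewrite exprn_gt0 // ltr0n.
have pt1 x : big x -> dotp (pt x) (pt x) = 1.
  by move=> bx; apply: dotp_normalize; apply: lt_le_trans (sq_large _ bx).
have pt_neg x : pt (negv _ x) = - pt x.
  by rewrite /pt sq_neg blocksums_negb normalizeN.
have A_neg x : A (negv _ x) = A x by rewrite /A sq_neg (altcount_negb None).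
have A_gt0 x : x != zerov M -> (0 < A x)%N.
  move=> /first_sq; rewrite /A; case fx : (first_sign _) => [b|] // _.
  by rewrite (altcount_first_sign b) fx eqxx.
have A_le x : (A x <= M)%N by rewrite -(size_sq x) altcount_size.
have nM : (n.+1 <= M)%N by rewrite leq_pmulr.
(* Labels of big vectors start at [M - n.+1], just above those of the others. As [l] differs at
   antipodes, the minimum is below [n], which keeps [(lab x).+1 < M]; [sgn] records which antipode
   attains it. *)
pose lab x := if big x then (M - n.+1 + minn (l (pt x)) (l (- pt x)))%N else (A x).-1.
pose sgn x := if big x then (l (pt x) < l (- pt x))%N else first_sign (sq x) == Some true.
have big_neg x : big (negv _ x) = big x by rewrite /big A_neg.
have ltl x : big x -> (l (pt x) != l (- pt x) :> nat) by move=> /pt1/nol.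
have := @octahedral_tucker M lab sgn.
case=> [x x0|x x0||x x0|x [y [x0 xy labxy sgnxy]]].
- by rewrite /lab big_neg A_neg pt_neg opprK minnC.
- rewrite /sgn big_neg pt_neg opprK; case: ifP => [/ltl|_]; first by lia.
  have := first_sq _ x0; rewrite sq_neg first_sign_negb.
  by case: (first_sign _) => [[]|].
- exact: leq_trans nM.
- rewrite /lab; case: ifP => [bx|]; last by rewrite /big; have := A_gt0 _ x0; lia.
  have := ltl _ bx; have := ltn_ord (l (pt x)); have := ltn_ord (l (- pt x)); lia.
have xys : extends (sq x) (sq y).
  rewrite /sq; elim: (enum _) => //= i r ->; rewrite andbT.
  by have [//|/xy ->] := eqVneq (x i) None; rewrite eqxx.
have Axy : (A x <= A y)%N by apply: altcount_extends.
have Ax0 := A_gt0 _ x0.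
move: labxy sgnxy; rewrite /lab /sgn.
have [bx|bx] := boolP (big x); last first.
  have [by_|by_] := boolP (big y); first by move: bx; rewrite /big; lia.
  move=> labxy /eqP[]; congr (_ == _); apply: first_sign_extends => //.
  by rewrite -/(A x) -/(A y); lia.
have by_ : big y by move: bx; rewrite /big; lia.
rewrite by_ => /addnI labxy sgnxy.
have close : 1 - e <= dotp (pt x) (pt y).
  apply: (normalize_close _ _ _ _ (L%:R ^+ 2)) => //; [exact: ltW|exact: sq_large|exact: sq_large|].
  apply: le_trans (blocksums_close _ _ _ _ _ (size_sq x) xys bx) _.
  have : n.+1%:R ^+ 3 <= e * L0%:R by rewrite mulrC -ler_pdivrMr.
  have : L0%:R <= L%:R ^+ 2 :> R by rewrite -natrX ler_nat /L; lia.
  by rewrite -(ler_pM2l e0); have := exprn_gt0 2 (ltr0Sn R L0); nra.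
(* The equal minima are attained on opposite sides, so [l] agrees at [pt x] and [- pt y], or at
   [- pt x] and [pt y]. *)
have [xlt|xlt] := ltnP (l (pt x)) (l (- pt x)); last first.
  exists (- pt x), (pt y); rewrite !dotpNr !dotpNl opprK !pt1 //; split=> //; last by lra.
  by apply: val_inj => /=; have := ltl _ by_; have := ltl _ bx; lia.
exists (pt x), (- pt y); rewrite !dotpNr !dotpNl opprK !pt1 //; split=> //; last by lra.
by apply: val_inj => /=; have := ltl _ by_; have := ltl _ bx; lia.
Qed.

(** * Quantitative trigonometry *)

Section Trigo.
Variable R : realType.
Implicit Types t x : R.

(** By the mean value theorem. The next four bounds each integrate the preceding one, starting from
    [cos x <= 1]. *)
Lemma ge0_from_derive (f df : R -> R) t : 0 <= t ->
  (forall x, is_derive x 1 f (df x)) -> f 0 = 0 ->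
  (forall x, 0 <= x <= t -> 0 <= df x) -> 0 <= f t.
Proof.
move=> t0 dff f0 df0.
have cf : {within `[0, t], continuous f}%classic.
  apply: continuous_subspaceT => x.
  by apply/differentiable_continuous/derivable1_diffP; have [] := dff x.
have [c /[!in_itv]/= ct] := MVT_segment t0 (fun x _ => dff x) cf.
rewrite f0 !subr0 => ->; apply: mulr_ge0 => //.
exact: df0.
Qed.

Lemma sin_le t : 0 <= t -> sin t <= t.
Proof.
move=> t0; rewrite -subr_ge0.
apply: (ge0_from_derive (fun x => x - sin x) (fun x => 1 - cos x)) => //.
- by rewrite sin0 subr0.
Qed.

Lemma cos_ge t : 0 <= t -> 1 - t ^+ 2 / 2 <= cos t.
Proof.
move=> t0; rewrite -subr_ge0.
apply: (ge0_from_derive (fun x => cos x - (1 - x ^+ 2 / 2)) (fun x => x - sin x)) => //.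
- move=> x; apply: is_derive_eq; rewrite /GRing.scale /=; lra.
- by rewrite cos0; lra.
- by move=> x /andP[x0 _]; rewrite subr_ge0 sin_le.
Qed.

Lemma sin_ge_half t : 0 <= t <= 1 -> t / 2 <= sin t.
Proof.
move=> /andP[t0 t1]; rewrite -subr_ge0.
apply: (ge0_from_derive (fun x => sin x - x / 2) (fun x => cos x - 1 / 2)) => //.
- move=> x; apply: is_derive_eq; rewrite /GRing.scale /=; lra.
- by rewrite sin0; lra.
- by move=> x /andP[x0 xt]; have := cos_ge _ x0; nra.
Qed.

Lemma cos_le t : 0 <= t <= 1 -> cos t <= 1 - t ^+ 2 / 4.
Proof.
move=> /andP[t0 t1]; rewrite -subr_ge0.
apply: (ge0_from_derive (fun x => 1 - x ^+ 2 / 4 - cos x) (fun x => sin x - x / 2)) => //.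
- move=> x; apply: is_derive_eq; rewrite /GRing.scale /=; lra.
- by rewrite cos0; lra.
- by move=> x /andP[x0 xt]; have := sin_ge_half x; rewrite x0 (le_trans xt) // subr_ge0 => ->.
Qed.

Lemma acos_le x y : -1 <= x -> x <= y -> y <= 1 -> acos y <= acos x.
Proof.
move=> x1 xy y1.
have xB : -1 <= x <= 1 by rewrite x1 (le_trans xy).
have yB : -1 <= y <= 1 by rewrite y1 (le_trans x1).
rewrite leNgt -ltr_cos ?acosK ?in_itv //= -?leNgt //.
- by rewrite acos_ge0 ?acos_lepi.
- by rewrite acos_ge0 ?acos_lepi.
Qed.

Lemma acos_le_angle x t : 0 <= t <= 1 -> -1 <= x <= 1 -> 1 - t ^+ 2 / 4 <= x -> acos x <= t.
Proof.
move=> /andP[t0 t1] /andP[x1 x2] xt.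
have tpi : t <= pi by have := pi_ge2 R; lra.
rewrite -[leRHS]cosK ?in_itv /= ?t0 //; apply: acos_le => //; first exact: cos_geN1.
by apply: le_trans xt; apply: cos_le; rewrite t0.
Qed.

Lemma acos_ge_angle x t : 0 <= t <= pi -> -1 <= x <= 1 -> x <= 1 - t ^+ 2 / 2 -> t <= acos x.
Proof.
move=> /andP[t0 tpi] /andP[x1 x2] xt.
rewrite -[leLHS]cosK ?in_itv /= ?t0 //; apply: acos_le => //.
by apply: le_trans (cos_ge _ t0).
Qed.

End Trigo.

(** * A correspondence of small distortion *)

Lemma nat_sqrt_floor (N : nat) : exists a, (a ^ 2 <= N < a.+1 ^ 2)%N.
Proof.
elim: N => [|N [a /andP[aN Na]]]; first by exists 0%N.
have [e|ne] := eqVneq N.+1 (a.+1 ^ 2)%N.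
  by exists a.+1; rewrite e leqnn ltn_exp2r //=.
by exists a; rewrite leqW //= ltn_neqAle ne.
Qed.

Section Dominant.
Variables (R : realType) (m : nat).
Implicit Types (i : 'I_m) (b : bool) (x y : 'rV[R]_m).

(* [x] lies in the Voronoi cell of [(-1) ^+ b *: delta_mx ord0 i] among the
   points [+- e_j]. *)
Definition dominant i b x := forall j, `|x ord0 j| <= (-1) ^+ b * x ord0 i.

Lemma dominant_exists x : (0 < m)%N -> exists i b, dominant i b x.
Proof.
move=> m0; pose i := [arg max_(i > Ordinal m0) `|x ord0 i|]%O.
exists i, (x ord0 i < 0) => j.
have -> : (-1) ^+ (x ord0 i < 0)%R * x ord0 i = `|x ord0 i|.
  by case: (ltP (x ord0 i) 0) => [/ltr0_norm|/ger0_norm] ->; rewrite ?mulN1r ?mul1r.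
by rewrite /i; case: arg_maxP => //= i' _; apply.
Qed.

Lemma dominant_sqr i b x : dotp x x = 1 -> dominant i b x -> 1 / m%:R <= x ord0 i ^+ 2.
Proof.
have m0 : 0 < m%:R :> R by rewrite ltr0n; case: (i) => i' /=; lia.
move=> x1 dx; rewrite ler_pdivrMr // mulrC -[leLHS]x1 /dotp.
have -> : m%:R * x ord0 i ^+ 2 = \sum_(j < m) x ord0 i ^+ 2.
  by rewrite sumr_const card_ord mulr_natl.
apply: ler_sum => j _; rewrite -expr2 -real_normK ?num_real // -[leRHS]real_normK ?num_real //.
rewrite ler_sqr ?nnegrE //; apply: le_trans (dx j) _.
suff -> : `|x ord0 i| = `|(-1) ^+ b * x ord0 i| by exact: ler_norm.
by rewrite normrM normr_sign mul1r.
Qed.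

Lemma dominant_ge0 i b x : dominant i b x -> 0 <= (-1) ^+ b * x ord0 i.
Proof. by move=> /(_ i); apply: le_trans. Qed.

Lemma dominantZ i b b' x : dominant i b x -> dominant i (b' (+) b) ((-1) ^+ b' *: x).
Proof.
by move=> dx j; rewrite !mxE normrM normr_sign mul1r signr_addb mulrACA -expr2 sqrr_sign mul1r.
Qed.

Lemma dotp_coordinate_le i x y : dotp x x = 1 -> dotp y y = 1 ->
  dotp x y <= 1 - (x ord0 i - y ord0 i) ^+ 2 / 2.
Proof.
move=> x1 y1; have : (x ord0 i - y ord0 i) ^+ 2 <= dotp (x - y) (x - y).
  rewrite /dotp (bigD1 i) //= !mxE -expr2 lerDl sumr_ge0 // => j _.
  exact: sqr_ge0.
rewrite !dotpDl !dotpDr !dotpNl !dotpNr x1 y1 (dotpC _ _ y x); lra.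
Qed.

(** The [i]-th coordinates have opposite signs and absolute value at least [1 / sqrt m], so they
    differ by at least [2 / sqrt m]. *)
Lemma dotp_dominant_opp i b x y : dotp x x = 1 -> dotp y y = 1 ->
  dominant i b x -> dominant i (~~ b) y -> dotp x y <= 1 - 2 / m%:R.
Proof.
move=> x1 y1 dx dy; apply: le_trans (dotp_coordinate_le i _ _ x1 y1) _.
have := dominant_sqr _ _ _ x1 dx; have := dominant_sqr _ _ _ y1 dy.
have := dominant_ge0 _ _ _ dx; have := dominant_ge0 _ _ _ dy.
set X := x ord0 i; set Y := y ord0 i => h1 h2 h3 h4.
have mE : 2 / m%:R = 2 * (1 / m%:R) :> R by rewrite mulrA mulr1.
rewrite mE; move: (1 / _) h3 h4 => r h3 h4.
suff : r <= - (X * Y) by lra.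
have XY : 0 <= - (X * Y).
  by have := mulr_ge0 h1 h2; case: (b); rewrite /= ?expr0 ?expr1; lra.
have [r0|r0] := leP r 0; first exact: le_trans XY.
by rewrite -ler_sqr ?nnegrE ?(ltW r0) // sqrrN exprMn expr2 mulrC; apply: ler_pM => //; exact: ltW.
Qed.

(** The coordinate bound for [x] and [- y]: the coordinates have the same sign, so
    [(X + Y)^2 >= X^2 + Y^2 >= 2 / m]. *)
Lemma dotp_dominant_same i b x y : dotp x x = 1 -> dotp y y = 1 ->
  dominant i b x -> dominant i b y -> - 1 + 1 / m%:R <= dotp x y.
Proof.
move=> x1 y1 dx dy.
have y1' : dotp (- y) (- y) = 1 by rewrite dotpNl dotpNr opprK.
have := dotp_coordinate_le i _ _ x1 y1'; rewrite dotpNr mxE.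
have := dominant_sqr _ _ _ x1 dx; have := dominant_sqr _ _ _ y1 dy.
have := mulr_ge0 (dominant_ge0 _ _ _ dx) (dominant_ge0 _ _ _ dy).
rewrite mulrACA -expr2 sqrr_sign mul1r.
set X := x ord0 i; set Y := y ord0 i => h1 h3 h4.
lra.
Qed.

End Dominant.

(** * Well-separated lines in three-space *)

Section Lines.
Variable R : realType.

Definition vec3 (a b c : R) : 'rV[R]_3 := \row_i [:: a; b; c]`_i.

Lemma dotp_vec3 a b c a' b' c' :
  dotp (vec3 a b c) (vec3 a' b' c') = a * a' + b * b' + c * c'.
Proof. by rewrite /dotp !big_ord_recl big_ord0 !mxE /= addr0 addrA. Qed.

(* Lagrange's identity: the squared sine of the angle is the squared norm of the
   cross product over the product of the squared norms. *)
Lemma dotp_normalize_lagrange (u v : R * R * R) (m : nat) : (0 < m)%N ->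
  let V w := vec3 w.1.1 w.1.2 w.2 in
  0 < dotp (V u) (V u) <= 3 * m%:R ^+ 2 -> 0 < dotp (V v) (V v) <= 3 * m%:R ^+ 2 ->
  m%:R ^+ 2 <= (u.1.2 * v.2 - u.2 * v.1.2) ^+ 2 + (u.2 * v.1.1 - u.1.1 * v.2) ^+ 2
    + (u.1.1 * v.1.2 - u.1.2 * v.1.1) ^+ 2 ->
  `|dotp (normalize _ _ (V u)) (normalize _ _ (V v))| <= 1 - 1 / (18 * m%:R ^+ 2).
Proof.
move=> m0 V; case: u => [[a b] c]; case: v => [[a' b'] c'] /= /andP[u0 um] /andP[v0 vm] h.
have M0 : 0 < m%:R ^+ 2 :> R by rewrite exprn_gt0 // ltr0n.
have M1 : 1 <= m%:R ^+ 2 :> R by rewrite -natrX ler1n expn_gt0 m0.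
rewrite dotpZl dotpZr.
have := sqr_sqrtr (ltW u0); have := sqr_sqrtr (ltW v0).
have : 0 < Num.sqrt (dotp (V (a, b, c)) (V (a, b, c))) by rewrite sqrtr_gt0.
have : 0 < Num.sqrt (dotp (V (a', b', c')) (V (a', b', c'))) by rewrite sqrtr_gt0.
move: (Num.sqrt (dotp (V (a, b, c)) _)) (Num.sqrt (dotp (V (a', b', c')) _)) => p q q0 p0 qE pE.
move: u0 um v0 vm; rewrite -pE -qE => u0 um v0 vm.
move: pE qE; rewrite /V !dotp_vec3 /= => pE qE.
set d := a * a' + b * b' + c * c'.
have lag : d ^+ 2 + m%:R ^+ 2 <= p ^+ 2 * q ^+ 2.
  by rewrite pE qE /d; lra.
have r0 : 0 <= 1 - 1 / (18 * m%:R ^+ 2) :> R.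
  by rewrite subr_ge0 ler_pdivrMr; lra.
rewrite mulrA -invfM mulrC -ler_sqr ?nnegrE // real_normK ?num_real //.
rewrite exprMn exprVn ler_pdivrMr ?exprn_gt0 ?mulr_gt0 //.
(* The squared sine is at least [m^2 / (9 m^4)]; then [1 - 2 a <= (1 - a)^2] with
   [a = 1 / (18 m^2)]. *)
have pq : (q * p) ^+ 2 <= 9 * m%:R ^+ 2 * m%:R ^+ 2.
  rewrite exprMn; have := ler_pM (ltW v0) (ltW u0) vm um; lra.
set M := m%:R ^+ 2 in lag M0 M1 r0 pq um vm *.
have h1 : 1 / (9 * M) * (q * p) ^+ 2 <= M.
  by rewrite mulrAC mul1r ler_pdivrMr; lra.
have h2 : 1 - 1 / (9 * M) <= (1 - 1 / (18 * M)) ^+ 2.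
  have -> : 1 / (9 * M) = 2 * (1 / (18 * M)) by field; lra.
  by have := sqr_ge0 (1 / (18 * M)); lra.
have := ler_wpM2r (sqr_ge0 (q * p)) h2; rewrite [(q * p) ^+ 2]exprMn in h1 *; lra.
Qed.

(** Two axis points and the lattice points [(a, b, m)]; index 2 gives [(0, 0, m)], the third axis.
    By integrality, cross products of distinct points have length at least [m]. *)
Definition grid_point (m i : nat) : nat * nat * nat :=
  match i with
  | 0 => (m, 0, 0)
  | 1 => (0, m, 0)
  | i.+2 => ((i %/ m), (i %% m), m)
  end%N.

Lemma grid_lines (m n : nat) : (n <= m ^ 2)%N ->
  exists p : 'I_n -> 'rV[R]_3,
    [/\ forall i, dotp (p i) (p i) = 1,
        forall (i : 'I_n) (j : 'I_3), i = j :> nat -> dominant _ _ j false (p i)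
      & forall i j, i != j -> `|dotp (p i) (p j)| <= 1 - 1 / (18 * m%:R ^+ 2)].
Proof.
move=> nm; case: (posnP m) => [m0|m0].
  by exists (fun=> 0); split=> -[i ilt]; move: nm; rewrite m0; lia.
pose g (i : nat) : R * R * R :=
  ((grid_point m i).1.1%:R, (grid_point m i).1.2%:R, (grid_point m i).2%:R).
pose V (i : nat) := vec3 (g i).1.1 (g i).1.2 (g i).2.
have M0 : 0 < m%:R ^+ 2 :> R by rewrite exprn_gt0 // ltr0n.
have M1 : 1 <= m%:R ^+ 2 :> R by rewrite -natrX ler1n expn_gt0 m0.
have gm i : (i < n)%N -> 0 < dotp (V i) (V i) <= 3 * m%:R ^+ 2.
  move=> i_n; rewrite dotp_vec3 /g; case: i i_n => [|[|i]] i_n /=; [lra|lra|].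
  have := ltn_pmod i m0; have : (i %/ m < m)%N by rewrite ltn_divLR // mulnn; lia.
  rewrite -!(ltr_nat R); move: (i %/ m)%N (i %% m)%N => a b am bm.
  have a0 : 0 <= a%:R :> R by []. have b0 : 0 <= b%:R :> R by [].
  apply/andP; split; nra.
exists (fun i => normalize _ _ (V i)); split=> [i|i j ij|i j ij].
- by apply: dotp_normalize; have /andP[] := gm _ (ltn_ord i).
- rewrite ij => r; rewrite expr0 mul1r !mxE normrM ger0_norm ?invr_ge0 ?sqrtr_ge0 //.
  apply: ler_wpM2l; first by rewrite invr_ge0 sqrtr_ge0.
  rewrite /g; case: j r {ij} => [[|[|[|?]]] // ?] [[|[|[|?]]] // ?] /=;
    rewrite ?normr0 ?ger0_norm //.
    by rewrite div0n.
  by rewrite mod0n.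
apply: dotp_normalize_lagrange => //; [exact: gm|exact: gm|].
wlog ltij : i j ij / (i < j)%N.
  move=> H; have [|ji|e] := ltngtP i j; [exact: H| |]; last by rewrite (ord_inj e) eqxx in ij.
  have := H j i; rewrite eq_sym => /(_ ij ji); lra.
have := gm _ (ltn_ord i); rewrite /g {ij}.
case: i j ltij => [[|[|i]] ilt] [[|[|j]] jlt] //= ij _.
- by have := ler_wpM2r (ltW M0) M1; lra.
- by have := ler_wpM2r (ltW M0) M1; have := sqr_ge0 (m%:R * (j %% m)%:R : R); lra.
- by have := ler_wpM2r (ltW M0) M1; have := sqr_ge0 (m%:R * (j %/ m)%:R : R); lra.
have natsq (a b : nat) : a != b -> 1 <= (a%:R - b%:R) ^+ 2 :> R.
  by rewrite neq_ltn => /orP[]; rewrite -(ler_nat R) -natr1 => h; nra.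
set a := (i %/ m)%N; set b := (i %% m)%N; set a' := (j %/ m)%N; set b' := (j %% m)%N.
have cross := sqr_ge0 (a%:R * b'%:R - b%:R * a'%:R : R).
have [aa|/natsq aa] := eqVneq a a'; last first.
  have := ler_wpM2l (ltW M0) aa; have := sqr_ge0 (m%:R * (b%:R - b'%:R) : R); lra.
have /natsq bb : b != b'.
  apply/eqP => bb; move: ij; rewrite (divn_eq i m) (divn_eq j m).
  by rewrite -/a -/a' -/b -/b' aa bb ltnn.
have := ler_wpM2l (ltW M0) bb; have := sqr_ge0 (m%:R * (a%:R - a'%:R) : R); lra.
Qed.
End Lines.

Section Construction.
Variables (R : realType) (k : nat) (p : 'I_k.+1 -> 'rV[R]_3).

(** The first alternative makes the projection to [S^k] surjective, the second the projection to
    [S^2]. *)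
Definition axis_relation (q : 'rV[R]_3 * 'rV[R]_k.+1) : Prop :=
  dotp q.1 q.1 = 1 /\ dotp q.2 q.2 = 1 /\
  exists (i : 'I_k.+1) (b : bool), dominant R _ i b q.2 /\
    (q.1 = (-1) ^+ b *: p i \/
     exists j : 'I_3, [/\ i = j :> nat, q.2 = (-1) ^+ b *: delta_mx ord0 i
                        & dominant R _ j b q.1]).

Hypothesis p1 : forall i, dotp (p i) (p i) = 1.
Hypothesis p_dom : forall (i : 'I_k.+1) (j : 'I_3), i = j :> nat -> dominant R _ j false (p i).

Lemma dotp_signZ (m : nat) b (x : 'rV[R]_m) : dotp ((-1) ^+ b *: x) ((-1) ^+ b *: x) = dotp x x.
Proof. by rewrite dotpZl dotpZr mulrA -expr2 sqrr_sign mul1r. Qed.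

Lemma dotp_deltar (m : nat) (x : 'rV[R]_m) i : dotp x (delta_mx ord0 i) = x ord0 i.
Proof.
rewrite /dotp (bigD1 i) //= big1 => [|j ji]; rewrite mxE ?eqxx ?mulr1 ?addr0 //=.
by rewrite (negPf ji) mulr0.
Qed.

Lemma axis_relation_opp y x : axis_relation (y, x) -> axis_relation (- y, - x).
Proof.
have oppE m (v : 'rV[R]_m) : - v = (-1) ^+ true *: v by rewrite expr1 scaleN1r.
rewrite (oppE _ y) (oppE _ x).
move=> [/= y1 [x1 [i [b [dx h]]]]]; split; first by rewrite dotp_signZ.
split; first by rewrite dotp_signZ.
exists i, (true (+) b); split; first exact: dominantZ.
case: h => /= [->|[j [ij -> dy]]]; [left|right; exists j; split=> //].
- by rewrite scalerA expr1 mulN1r signrN.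
- by rewrite scalerA expr1 mulN1r signrN.
exact: (dominantZ _ _ _ b true _ dy).
Qed.

Lemma axis_relation_correspondence : (2 <= k)%N ->
  correspondence (@sphere R 2) (@sphere R k) axis_relation.
Proof.
move=> k2; split.
- by move=> q [q1 [q2 _]]; split.
- apply/seteqP; split=> [y [q [q1 _] <-] //|y y1].
  have [j [b dy]] := dominant_exists R 3 y isT.
  have jk : (j < k.+1)%N by apply: leq_trans (ltn_ord j) _.
  exists (y, (-1) ^+ b *: delta_mx ord0 (Ordinal jk)) => //; split=> //; split=> /=.
    by rewrite dotp_signZ dotp_deltar mxE !eqxx.
  exists (Ordinal jk), b; split; last by right; exists j.
  rewrite -[b in dominant _ _ _ b]addbF; apply: dominantZ => r; rewrite !mxE eqxx expr0 mul1r.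
  by rewrite eqxx; case: (r == _); rewrite /= ?normr1 ?normr0.
- apply/seteqP; split=> [x [q [_ [q1 _]] <-] //|x x1].
  have [i [b dx]] := dominant_exists R k.+1 x isT.
  exists ((-1) ^+ b *: p i, x) => //; split=> /=; first by rewrite dotp_signZ.
  by split=> //; exists i, b; split=> //; left.
Qed.

Lemma dominant_off_axis (m : nat) (i j : 'I_m) b (x : 'rV[R]_m) : i != j ->
  dotp x x = 1 -> dominant R _ j b x -> `|x ord0 i| <= 3 / 4.
Proof.
move=> ij x1 dx; have xij : x ord0 i ^+ 2 + x ord0 j ^+ 2 <= 1.
  rewrite -x1 /dotp (bigD1 i) //= (bigD1 j) 1?eq_sym //= -!expr2 addrA lerDl.
  by apply: sumr_ge0 => r _; rewrite -expr2 sqr_ge0.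
have := dx i; have -> : (-1) ^+ b * x ord0 j = `|x ord0 j|.
  by rewrite -(ger0_norm (dominant_ge0 _ _ _ _ _ dx)) normrM normr_sign mul1r.
move: xij; rewrite -(real_normK (num_real (x ord0 i))) -(real_normK (num_real (x ord0 j))).
have := normr_ge0 (x ord0 i); have := normr_ge0 (x ord0 j).
by move: `|x ord0 i| `|x ord0 j| => s t s0 t0 st ts; nra.
Qed.

(** Same axis, opposite signs: the points of [S^k] lie in opposite cells. Same axis and sign: the
    points of [S^2] coincide or share a cell, where inner products are at least [- 2 / 3]. Different
    axes: either both points of [S^2] are signed [p]'s, or one point of [S^k] is a signed basis
    vector and the other lies off its axis. *)
Lemma axis_relation_dichotomy (kappa : R) q q' :
  3 / 4 <= kappa -> 1 - 2 / k.+1%:R <= kappa ->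
  (forall i j, i != j -> `|dotp (p i) (p j)| <= kappa) ->
  axis_relation q -> axis_relation q' ->
  dotp q.2 q'.2 <= kappa \/ - kappa <= dotp q.1 q'.1.
Proof.
case: q q' => [y x] [y' x'] k34 kk pp [/= y1 [x1 [i [b [dx h]]]]] [/= y1' [x1' [i' [b' [dx' h']]]]].
have [ii|ii] := eqVneq i i'.
  subst i'; have [bb|bb] := eqVneq b b'; last first.
    left; apply: le_trans kk; apply: dotp_dominant_opp x1 x1' dx _.
    by case: b b' bb dx' {h h'} => [] [].
  subst b'; right; case: h h' => [yE|[j [ij _ dy]]] h'.
    case: h' => [->|[j [ij _ dy']]].
      by rewrite yE dotp_signZ p1; lra.
    have dy : dominant R _ j b y by rewrite yE -[b in dominant _ _ _ b]addbF; apply/dominantZ/p_dom.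
    by have := dotp_dominant_same _ _ _ _ _ _ y1 y1' dy dy'; lra.
  have dy' : dominant R _ j b y'.
    case: h' => [->|[j' [ij' _ dy']]].
      by rewrite -[b in dominant _ _ _ b]addbF; apply/dominantZ/p_dom.
    by rewrite (_ : j = j') //; apply: ord_inj; rewrite -ij.
  by have := dotp_dominant_same _ _ _ _ _ _ y1 y1' dy dy'; lra.
case: h => [yE|[j [_ xE _]]]; last first.
  left; rewrite xE dotpC dotpZr dotp_deltar; apply: le_trans k34.
  apply: le_trans (ler_norm _) _; rewrite normrM normr_sign mul1r.
  exact: dominant_off_axis dx'.
case: h' => [yE'|[j [_ xE' _]]]; last first.
  left; rewrite xE' dotpZr dotp_deltar; apply: le_trans k34.
  apply: le_trans (ler_norm _) _; rewrite normrM normr_sign mul1r.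
  by apply: dominant_off_axis dx; rewrite // eq_sym.
right; rewrite yE yE' dotpZl dotpZr mulrA -signr_addb lerNl; apply: le_trans (pp _ _ ii).
by apply: le_trans (ler_norm _) _; rewrite normrN normrM normr_sign mul1r.
Qed.

(** The dichotomy bounds the difference of distances from one side. Replacing the second pair by its
    antipode turns each distance [s] into [pi - s], which gives the other side. *)
Lemma axis_relation_distortion (d : R) :
  0 <= d <= pi -> 3 / 4 <= 1 - d ^+ 2 / 2 -> 1 - 2 / k.+1%:R <= 1 - d ^+ 2 / 2 ->
  (forall i j, i != j -> `|dotp (p i) (p j)| <= 1 - d ^+ 2 / 2) ->
  (distortion (@geodesic R 3) (@geodesic R k.+1) axis_relation <= (pi - d)%:E)%E.
Proof.
move=> dpi d34 dk pd; apply: ge_ereal_sup => _ [q rq [q' rq' <-]]; rewrite lee_fin.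
have one_side (u v : 'rV[R]_3 * 'rV[R]_k.+1) : axis_relation u -> axis_relation v ->
    geodesic u.1 v.1 - geodesic u.2 v.2 <= pi - d.
  move=> ru rv; case: (ru) (rv) => [u1 [u2 _]] [v1 [v2 _]].
  have B1 := dotp_sphere_bound _ _ _ _ u1 v1; have B2 := dotp_sphere_bound _ _ _ _ u2 v2.
  rewrite /geodesic; have := acos_ge0 B2; have := acos_lepi B1.
  have [h|h] := axis_relation_dichotomy _ _ _ d34 dk pd ru rv.
    by have := acos_ge_angle _ _ _ dpi B2 h; lra.
  have B1' : -1 <= - dotp u.1 v.1 <= 1 by move: B1; lra.
  by have := acos_ge_angle _ _ _ dpi B1' _; rewrite acosN // lerNl => /(_ h); lra.
have := one_side _ _ rq rq'; case: q' rq' => y' x' rq'.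
have := one_side _ _ rq (axis_relation_opp _ _ rq').
case: rq rq' => [u1 [u2 _]] [/= v1 [v2 _]].
rewrite /geodesic /= !dotpNr !acosN ?dotp_sphere_bound //.
by move=> h1 h2; rewrite ler_norml; lra.
Qed.

End Construction.

Lemma sphere_correspondence_small_distortion (R : realType) (k : nat) : (2 < k)%N ->
  exists C : set ('rV[R]_3 * 'rV[R]_k.+1),
    correspondence (@sphere R 2) (@sphere R k) C /\
    (distortion (@geodesic R 3) (@geodesic R k.+1) C <= (pi - 9^-1 / Num.sqrt k%:R)%:E)%E.
Proof.
move=> k2; have [a /andP[a1 a2]] := nat_sqrt_floor k.+1.
have [p [p1 pdom psep]] := grid_lines R a.+1 k.+1 (ltnW a2).
exists (axis_relation R k p); split; first by apply: axis_relation_correspondence; rewrite // ltnW.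
(* With 9, [d^2 / 2 = 1 / (162 k)] stays below the separation [1 / (18 (a + 1)^2)], as
   [(a + 1)^2 <= 8 k]. *)
set d := 9^-1 / Num.sqrt k%:R.
have k0 : 0 < k%:R :> R by rewrite ltr0n; lia.
have k3 : 3 <= k%:R :> R by rewrite ler_nat.
have d2 : d ^+ 2 = 1 / (81 * k%:R).
  by rewrite exprMn !exprVn sqr_sqrtr ?ltW //; field; lra.
have d0 : 0 <= d by rewrite divr_ge0 ?sqrtr_ge0 // invr_ge0.
have kinv : 1 / k%:R <= 1 / 3 :> R by rewrite ler_pdivrMr //; lra.
have d2' : d ^+ 2 = 1 / 81 * (1 / k%:R) by rewrite d2; field; lra.
apply: axis_relation_distortion => //.
- rewrite d0 /=; have := pi_ge2 R; nra.
- by rewrite d2'; lra.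
- rewrite lerD2l lerN2 d2'; have -> : 2 / k.+1%:R = 2 * (1 / (k%:R + 1)) :> R.
    by rewrite -natr1; field; lra.
  have : 1 / k%:R <= 2 * (1 / (k%:R + 1)) :> R.
    by rewrite ler_pdivrMr // mul1r mulrAC ler_pdivlMr; lra.
  by have := divr_ge0 ler01 (ltW k0); lra.
move=> i j ij; apply: le_trans (psep _ _ ij) _; rewrite lerD2l lerN2.
have a8 : a.+1%:R ^+ 2 <= 8 * k%:R :> R.
  by rewrite -natrX -natrM ler_nat; nia.
have a0 : 0 < a.+1%:R ^+ 2 :> R by rewrite exprn_gt0 // ltr0Sn.
have -> : d ^+ 2 / 2 = 1 / (162 * k%:R) by rewrite d2; field; lra.
by rewrite !mul1r lef_pV2 ?posrE ?mulr_gt0 //; lra.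
Qed.

(** * Small cells of the 2-sphere *)

Section Cells.
Variables (R : realType) (m : nat).

(** A signed largest coordinate and a box of side [2 / m] for the other two; box index [m] occurs
    only at coordinate value 1. *)
Definition cell : finType := ('I_3 * bool * {ffun 'I_2 -> 'I_m.+1})%type.

Lemma card_cell : #|cell| = (6 * m.+1 ^ 2)%N.
Proof. by rewrite !card_prod card_bool card_ffun !card_ord. Qed.

Definition in_cell (y : 'rV[R]_3) (l : cell) : Prop :=
  dominant R _ l.1.1 l.1.2 y /\
  forall r, (l.2 r)%:R <= m%:R * (y ord0 (lift l.1.1 r) + 1) / 2 < (l.2 r)%:R + 1.

Lemma in_cell_exists y : dotp y y = 1 -> exists l, in_cell y l.
Proof.
move=> y1; have [j [b dy]] := dominant_exists R 3 y isT.
have /choice[f hf] : forall r : 'I_2, exists c : 'I_m.+1,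
    c%:R <= m%:R * (y ord0 (lift j r) + 1) / 2 < c%:R + 1.
  move=> r.
  set t := m%:R * _ / 2.
  have /andP[y_ge y_le] : -1 <= y ord0 (lift j r) <= 1.
    have := dotp_sphere_bound _ _ _ (delta_mx ord0 (lift j r)) y1.
    by rewrite !dotp_deltar mxE !eqxx; apply.
  have m0 : 0 <= m%:R :> R by [].
  have t0 : 0 <= t by rewrite divr_ge0 // mulr_ge0 //; lra.
  have tm : t <= m%:R by rewrite /t ler_pdivrMr //; apply: ler_wpM2l => //; lra.
  have /andP[h1 h2] := truncn_itv t0.
  have tr : (Num.truncn t < m.+1)%N by rewrite ltnS -(ler_nat R) (le_trans h1).
  by exists (Ordinal tr); rewrite /= h1 natr1.
by exists (j, b, [ffun r => f r]); split=> // r; rewrite ffunE.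
Qed.

(** The two smaller coordinates differ by at most [w = 2 / m]. As the points are unit, the squares
    of the largest ones [X], [X'] differ by at most [4 w]; since [(X + X')^2 >= 2 / 3],
    [(X - X')^2 <= 24 w^2]. In all [|y - y'|^2 <= 26 w^2], and [13 w^2 = 52 / m^2]. *)
Lemma in_cell_close l y y' : (0 < m)%N -> dotp y y = 1 -> dotp y' y' = 1 ->
  in_cell y l -> in_cell y' l -> 1 - 52 / m%:R ^+ 2 <= dotp y y'.
Proof.
move=> m_gt0 y1 y1' [dy cy] [dy' cy']; have m0 : 0 < m%:R :> R by rewrite ltr0n.
pose w := 2 / m%:R : R.
have gap r : `|y ord0 (lift l.1.1 r) - y' ord0 (lift l.1.1 r)| <= w.
  have := cy r; have := cy' r; move: (y _ _) (y' _ _) ((l.2 r)%:R) => s t c hs ht.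
  rewrite -(ler_pM2l m0) -{1}[m%:R]gtr0_norm // -normrM /w mulrCA divff ?gt_eqF // mulr1.
  by rewrite ler_norml; lra.
have sum3 (u v : 'rV[R]_3) : dotp u v = u ord0 l.1.1 * v ord0 l.1.1 +
    (u ord0 (lift l.1.1 ord0) * v ord0 (lift l.1.1 ord0) +
     u ord0 (lift l.1.1 (lift ord0 ord0)) * v ord0 (lift l.1.1 (lift ord0 ord0))).
  by rewrite /dotp (bigD1_ord l.1.1) //= !big_ord_recl big_ord0 addr0.
have : 0 <= y ord0 l.1.1 * y' ord0 l.1.1.
  have := mulr_ge0 (dominant_ge0 _ _ _ _ _ dy) (dominant_ge0 _ _ _ _ _ dy').
  by rewrite mulrACA -expr2 sqrr_sign mul1r.
have := dominant_sqr _ _ _ _ _ y1 dy; have := dominant_sqr _ _ _ _ _ y1' dy'.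
have := gap ord0; have := gap (lift ord0 ord0).
move: y1 y1'; rewrite !sum3.
have -> : 52 / m%:R ^+ 2 = 13 * w ^+ 2 by rewrite /w; field; rewrite gt_eqF.
have w0 : 0 <= w by rewrite divr_ge0.
clear gap sum3 cy cy' dy dy'.
move: (y ord0 l.1.1) (y' ord0 l.1.1) (y ord0 (lift l.1.1 ord0)) (y' ord0 (lift l.1.1 ord0))
  (y ord0 (lift l.1.1 (lift ord0 ord0))) (y' ord0 (lift l.1.1 (lift ord0 ord0))) w w0.
move=> X X' a a' c c' w w0 y1 y1'.
move=> cw aw hX' hX XX.
have sq_gap (s t : R) : `|s - t| <= w -> (s - t) ^+ 2 <= w ^+ 2.
  by move=> st; rewrite -(real_normK (num_real (s - t))) ler_sqr ?nnegrE.
have sum_bound (s t : R) : s ^+ 2 <= 1 -> t ^+ 2 <= 1 -> `|t + s| <= 2.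
  move=> s1 t1; rewrite -ler_sqr ?nnegrE // real_normK ?num_real //.
  by have := sqr_ge0 (s - t); lra.
have [[[sa sa'] sc] sc'] := (sqr_ge0 a, sqr_ge0 a', sqr_ge0 c, sqr_ge0 c').
have a2 : `|a' ^+ 2 - a ^+ 2| <= w * 2.
  rewrite subr_sqr normrM distrC; apply: ler_pM => //; apply: sum_bound; lra.
have c2 : `|c' ^+ 2 - c ^+ 2| <= w * 2.
  rewrite subr_sqr normrM distrC; apply: ler_pM => //; apply: sum_bound; lra.
have X2 : (X ^+ 2 - X' ^+ 2) ^+ 2 <= (w * 4) ^+ 2.
  rewrite -(real_normK (num_real (X ^+ 2 - _))) ler_sqr ?nnegrE ?mulr_ge0 //.
  by move: a2 c2; rewrite !ler_norml; lra.
have D0 : 0 <= (X - X') ^+ 2 by exact: sqr_ge0.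
have XX2 : 2 / 3 <= (X + X') ^+ 2 by lra.
have : (X - X') ^+ 2 * (2 / 3) <= (w * 4) ^+ 2.
  apply: le_trans X2; rewrite subr_sqr exprMn; exact: ler_wpM2l.
by have := sq_gap _ _ aw; have := sq_gap _ _ cw; lra.
Qed.

End Cells.

(* For [m < 15] the bound is trivial, as [pi <= 4]. *)
Lemma acos_le_inv (R : realType) (m : nat) (x : R) : (0 < m)%N -> -1 <= x <= 1 ->
  1 - 52 / m%:R ^+ 2 <= x -> acos x <= 60 / m%:R.
Proof.
move=> m_gt0 xB xm; have m0 : 0 < m%:R :> R by rewrite ltr0n.
have [m15|m15] := leqP 15 m.
  have m15' : 15 <= m%:R :> R by rewrite ler_nat.
  apply: (@le_trans _ _ (15 / m%:R)); last by rewrite ler_pM2r ?invr_gt0 //; lra.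
  apply: acos_le_angle => //.
    by rewrite divr_ge0 //= ler_pdivrMr; lra.
  apply: le_trans xm; rewrite lerD2l lerN2 expr_div_n mulrAC ler_pM2r ?invr_gt0 ?exprn_gt0 //; lra.
apply: le_trans (acos_lepi xB) _; rewrite ler_pdivlMr //.
have m15' : m%:R <= 15 :> R by rewrite ler_nat ltnW.
have pi4 : pi <= 4 :> R by have := pihalf_02 R; lra.
by have := pi_ge0 R; nra.
Qed.

(** * The lower bound on the distortion, and the theorem *)

Lemma leq_of_divn6_lt (k m : nat) :
  (k.+1 %/ 6 < m.+3 ^ 2)%N -> (k <= 64 * m.+1 ^ 2)%N.
Proof.
rewrite ltn_divLR // => k6.
(* This gives [k < 54 (m + 1)^2]; 64 is used since its root is 8. *)
have m3 : (m.+3 ^ 2 <= (3 * m.+1) ^ 2)%N by rewrite leq_exp2r //; lia.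
move: k6 m3; rewrite expnMn; move: (m.+3 ^ 2)%N (m.+1 ^ 2)%N => x y; lia.
Qed.

Lemma distortion_sphere_lower_bound (R : realType) (k : nat) (C : set ('rV[R]_3 * 'rV[R]_k.+1)) :
  (2 < k)%N -> correspondence (@sphere R 2) (@sphere R k) C ->
  ((pi - 481 / Num.sqrt k%:R)%:E <= distortion (@geodesic R 3) (@geodesic R k.+1) C)%E.
Proof.
move=> k2 [CXY C1 C2].
have k0 : 0 < k%:R :> R by rewrite ltr0n; lia.
have sk0 : 0 < Num.sqrt k%:R :> R by rewrite sqrtr_gt0.
have sk2 := sqr_sqrtr (ltW k0).
have pi4 : pi <= 4 :> R by have := pihalf_02 R; lra.
have dist p q : C p -> C q ->
    ((`|geodesic p.1 q.1 - geodesic p.2 q.2|)%:E <=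
      distortion (@geodesic R 3) (@geodesic R k.+1) C)%E.
  by move=> Cp Cq; apply: ereal_sup_ubound; exists p => //; exists q.
have lift_sphere (x : 'rV[R]_k.+1) : exists y, dotp x x = 1 -> C (y, x).
  have [x1|x1] := pselect (dotp x x = 1); last by exists 0.
  have : sphere x by [].
  by rewrite -C2 => -[[y x'] Cq /= <-]; exists y.
have [f Cf] := choice lift_sphere.
have f1 x : dotp x x = 1 -> dotp (f x) (f x) = 1.
  by move=> /Cf/CXY[].
(* For [k < 23] the bound [pi - 481 / sqrt k] is negative. From 23 on, [k.+1 %/ 6 >= 4], so [N >= 2]
   and the grid size [m.+1 = N - 1] is positive. *)
have [k23|k23] := ltnP k 23.
  have x1 : dotp (delta_mx ord0 ord0) (delta_mx ord0 ord0 : 'rV[R]_k.+1) = 1.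
    by rewrite dotp_deltar mxE !eqxx.
  apply: le_trans (dist _ _ (Cf _ x1) (Cf _ x1)); rewrite lee_fin.
  apply: le_trans (normr_ge0 _).
  have s5 : Num.sqrt k%:R <= 5 :> R.
    have k25 : k%:R <= 25 :> R by rewrite ler_nat; lia.
    by rewrite -ler_sqr ?nnegrE ?(ltW sk0) // sk2; lra.
  by rewrite subr_le0 ler_pdivlMr //; have := pi_ge0 R; nra.
have [N /andP[]] := nat_sqrt_floor (k.+1 %/ 6).
case: N => [|[|m]] N1 N2; [lia|lia|].
have cell_le : (#|cell m.+1| <= k.+1)%N by rewrite card_cell; lia.
have /choice[lab labP] : forall y : 'rV[R]_3, exists l : cell m.+1,
    dotp y y = 1 -> in_cell R _ y l.
  move=> y.
  have [y1|y1] := pselect (dotp y y = 1); last by exists (ord0, true, [ffun=> ord0]).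
  by have [l hl] := in_cell_exists R m.+1 y y1; exists l.
pose l (x : 'rV[R]_k.+1) := widen_ord cell_le (enum_rank (lab (f x))).
set t := (Num.sqrt k%:R)^-1 : R.
have t0 : 0 < t by rewrite invr_gt0.
have t1 : t <= 1.
  have k1 : 1 <= k%:R :> R by rewrite ler1n; lia.
  by rewrite invf_le1 // -ler_sqr ?nnegrE ?(ltW sk0) // sk2; lra.
(* With this [e], [acos_le_angle] puts [v] within [t] of the antipode of [w]. *)
have e0 : 0 < t ^+ 2 / 4 :> R by rewrite divr_gt0 // exprn_gt0.
have [v [w [v1 w1 lvw vw]]] := sphere_labels_near_antipodes R k l _ e0.
have {}lvw : lab (f v) = lab (f w).
  by apply: enum_rank_inj; apply: ord_inj; have := congr1 val lvw.
apply: le_trans (dist _ _ (Cf _ v1) (Cf _ w1)); rewrite lee_fin /=.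
have fvw := in_cell_close R m.+1 _ _ _ isT (f1 _ v1) (f1 _ w1) (labP _ (f1 _ v1)).
rewrite lvw in fvw; have {}fvw := fvw (labP _ (f1 _ w1)).
have := acos_le_inv R m.+1 _ isT (dotp_sphere_bound _ _ _ _ (f1 _ v1) (f1 _ w1)) fvw.
have vwB := dotp_sphere_bound _ _ _ _ v1 w1.
have NB : -1 <= - dotp v w <= 1 by move: vwB; lra.
have := acos_le_angle _ _ t _ NB; rewrite acosN // t1 ltW // => /(_ isT) vwt.
have {}vwt : pi - acos (dotp v w) <= t by apply: vwt; move: vw; lra.
have mk : Num.sqrt k%:R <= 8 * m.+1%:R :> R.
  have km : k%:R <= (64 * m.+1 ^ 2)%:R :> R by rewrite ler_nat; exact: leq_of_divn6_lt.
  rewrite natrM natrX in km.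
  by rewrite -ler_sqr ?nnegrE ?(ltW sk0) ?mulr_ge0 // sk2; lra.
(* The partners are within [480 t], and the antipodal defect [t] makes 481. *)
have : 60 / m.+1%:R <= 480 / Num.sqrt k%:R :> R.
  by rewrite ler_pdivrMr // mulrAC ler_pdivlMr //; lra.
rewrite -/t => h1 h2; rewrite /geodesic distrC; apply: le_trans (ler_norm _).
have combine (a b u : R) : u <= 480 * t -> b <= u -> pi - a <= t -> pi - 481 * t <= a - b.
  lra.
exact: combine h1 h2 vwt.
Qed.

Theorem corollary1p5 (R : realType) :
  exists c C : R,
    [/\ 0 < c, c <= C &
      forall k : nat, (2 < k)%N ->
        ((c / Num.sqrt k%:R)%:E <= pi%:E - 2%:E * gh_sphere R 2 k)%E /\
        (pi%:E - 2%:E * gh_sphere R 2 k <= (C / Num.sqrt k%:R)%:E)%E].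
Proof.
exists 9^-1, 481; split=> [||k k2]; [lra|lra|].
rewrite /gh_sphere /gh_dist muleA -EFinM mulfV // mul1e.
set I := ereal_inf _.
have Ihi : (I <= (pi - 9^-1 / Num.sqrt k%:R)%:E)%E.
  have [C [corrC disC]] := sphere_correspondence_small_distortion R k k2.
  by apply: le_trans disC; apply: ereal_inf_lbound; exists C.
have Ilo : ((pi - 481 / Num.sqrt k%:R)%:E <= I)%E.
  by apply: le_ereal_inf_tmp => _ [C corrC <-]; exact: distortion_sphere_lower_bound.
move: I Ilo Ihi => [r| |] //=; rewrite !lee_fin => lo hi.
by split; lra.
Qed.
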